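(* Let $n\ge 0$ be an integer and let $x,y$ be complex numbers such that no denominator below vanishes, i.e. $x\notin\{-1,\dots,-n\}$, $x-y\notin\{-1,\dots,-n\}$ and $y\notin\{0,-1,\dots,-n\}$. Then $$\sum_{k=0}^n(-1)^k\binom{n}{k}\frac{\binom{2x-y+n+k}{k}\binom{y+k}{k}}{\binom{x+k}{k}^2}\frac{y}{y+k}H_{k}^{\langle2\rangle}(x)=\frac{\binom{x-y+n}{n}^2}{\binom{x+n}{n}^2}\Big\{H_{n}^{\langle2\rangle}(x)-H_{n}^{\langle2\rangle}(x-y)\Big\}.$$
   Context: For a complex number $u$ and an integer $k\ge 0$, $\binom{u}{k}=\frac{u(u-1)\cdots(u-k+1)}{k!}$ (equal to $1$ for $k=0$). For a complex number $u$ and a positive integer $\ell$, the generalized harmonic numbers of $\ell$-order are $H_0^{\langle\ell\rangle}(u)=0$ and $H_n^{\langle\ell\rangle}(u)=\sum_{k=1}^n\frac{1}{(u+k)^\ell}$ for $n\ge1$. *)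

(* Defs.v *)
From mathcomp Require Import all_boot all_order all_algebra.
From mathcomp Require Import reals complex.

Set Implicit Arguments.
Unset Strict Implicit.
Unset Printing Implicit Defensive.

Import GRing.Theory.
Local Open Scope ring_scope.

(* u (u - 1) ... (u - k + 1) / k!; the division by k`! is only meaningful
   when F has characteristic 0. *)
Definition gbinom (F : fieldType) (u : F) (k : nat) : F :=
  (\prod_(i < k) (u - i%:R)) / (k`!)%:R.

Definition gharm (F : fieldType) (l n : nat) (u : F) : F :=
  \sum_(1 <= k < n.+1) 1 / (u + k%:R) ^+ l.

(* Main.v *)
(** For a parameter [s], let [S(s)] be the sum over [k] of
    [(-1)^k C(n,k) (y)_k (2x-y+n+1)_k \prod_(k < j <= n) ((x+j)^2 - s)].
    The Pfaff-Saalschütz sum with lower parameters [x + 1 + t] and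
    [x + 1 - t], [s = t^2], evaluates it to
    [\prod_(1 <= j <= n) ((x-y+j)^2 - s)]; this follows from a first-order
    recurrence in [n] that telescopes in [k].  The harmonic numbers of order 2
    come from differentiating with respect to [s] at [s = 0]. *)
Require Import Defs.
From mathcomp Require Import all_boot all_order all_algebra.
From mathcomp Require Import reals complex.
From mathcomp Require Import ring.

Set Implicit Arguments.
Unset Strict Implicit.
Unset Printing Implicit Defensive.

Import GRing.Theory.
Local Open Scope ring_scope.

Definition rising (A : comNzRingType) (a : A) (k : nat) : A :=
  \prod_(0 <= i < k) (a + i%:R).

(** With [s] = t^2 and [k <= n] this is (x+1+t)_n (x+1-t)_n / ((x+1+t)_k (x+1-t)_k). Keeping only
    the tail product avoids denominators, so the summation identity makes sense in any commutative
    ring, polynomials in [s] included. *)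
Definition shifted_squares (A : comNzRingType) (x s : A) (k n : nat) : A :=
  \prod_(k <= j < n) ((x + j.+1%:R) ^+ 2 - s).

Definition rising_coef (A : comNzRingType) (x y : A) (n k : nat) : A :=
  (-1) ^+ k * 'C(n, k)%:R
  * (rising y k * rising (2%:R * x - y + n.+1%:R) k).

Section PfaffSaalschutz.

Variable A : comNzRingType.
Implicit Types a x y s : A.

Lemma risingS a k : rising a k.+1 = rising a k * (a + k%:R).
Proof. by rewrite /rising big_nat_recr. Qed.

Lemma rising_recl a k : rising a k.+1 = a * rising (a + 1) k.
Proof.
rewrite /rising big_nat_recl // addr0; congr (_ * _).
by apply: eq_bigr => i _; rewrite -addrA -natr1 [1 + _]addrC.
Qed.

Lemma shifted_squaresS x s k n : (k <= n)%N ->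
  shifted_squares x s k n.+1
  = shifted_squares x s k n * ((x + n.+1%:R) ^+ 2 - s).
Proof. by move=> kn; rewrite /shifted_squares big_nat_recr. Qed.

Lemma shifted_squares_recl x s k n : (k < n)%N ->
  shifted_squares x s k n
  = ((x + k.+1%:R) ^+ 2 - s) * shifted_squares x s k.+1 n.
Proof. by move=> kn; rewrite /shifted_squares big_ltn. Qed.

(* The right-hand side is Zeilberger's certificate for the recurrence in [n]. *)
Lemma rising_sum_telescope x y s n m : (m <= n)%N ->
  \sum_(0 <= k < m.+1)
    (rising_coef x y n.+1 k * shifted_squares x s k n.+1
     - ((x - y + n.+1%:R) ^+ 2 - s)
       * (rising_coef x y n k * shifted_squares x s k n))
  = (2%:R * x - y + (2 * n.+1)%:R) * (-1) ^+ m * 'C(n, m)%:R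
    * rising y m.+1 * rising (2%:R * x - y + n.+2%:R) m
    * shifted_squares x s m n.
Proof.
elim: m => [|m IHm] le_mn.
  rewrite big_nat1 /rising_coef !bin0 shifted_squaresS //.
  rewrite risingS /rising !big_geq // natrM -[n.+1%:R]natr1; ring.
rewrite big_nat_recr //= IHm ?(ltnW le_mn) // /rising_coef.
rewrite (shifted_squares_recl x s le_mn) shifted_squaresS //.
rewrite [rising y m.+2]risingS.
rewrite [rising (2%:R * x - y + n.+1%:R) m.+1]rising_recl.
have -> : 2%:R * x - y + n.+1%:R + 1 = 2%:R * x - y + n.+2%:R.
  by rewrite -addrA natr1.
rewrite [rising (2%:R * x - y + n.+2%:R) m.+1]risingS binS natrD natrM.
have absorb : m.+1%:R * 'C(n, m.+1)%:R = (n%:R - m%:R) * 'C(n, m)%:R :> A.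
  by rewrite -natrB ?(ltnW le_mn) // -!natrM mul_bin_left.
rewrite [(-1) ^+ m.+1]exprS -[n.+2%:R]natr1 -[n.+1%:R]natr1.
move: absorb; rewrite -[m.+1%:R]natr1.
set c := 'C(n, m)%:R; set c' := 'C(n, m.+1)%:R => absorb.
set r := rising y m.+1; set r' := rising _ m; set q := shifted_squares _ _ _ _.
set e := (-1) ^+ m.
apply/eqP; rewrite -subr_eq0; apply/eqP.
set X := x + (n%:R + 1); set d := 2%:R * x - y + 2%:R * (n%:R + 1).
(* Without division, the difference of the two sides must be exhibited as a multiple of the relation
   [absorb]. The cofactor is the coefficient of [c'] in that difference, divided by [m + 1]; note
   that [x - y + n + 1] is [d - X] and [y] is [2 X - d]. *)
transitivity (- e * r * r' * q * (X ^+ 2 - 2%:R * d * X + d * (n%:R - m%:R) - s)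
    * ((m%:R + 1) * c' - (n%:R - m%:R) * c)); last by rewrite absorb subrr mulr0.
rewrite /X /d; ring.
Qed.

Lemma pfaff_saalschutz x y s n :
  \sum_(0 <= k < n.+1) rising_coef x y n k * shifted_squares x s k n
  = shifted_squares (x - y) s 0 n.
Proof.
elim: n => [|n IHn].
  rewrite big_nat1 /rising_coef /rising /shifted_squares !big_geq //.
  by rewrite bin0 !mulr1.
rewrite (shifted_squaresS (x - y)) // -IHn.
rewrite [RHS]mulrC mulr_sumr; apply/eqP; rewrite -subr_eq0 big_nat_recr //=.
(* At [m = n] the certificate leaves one boundary term, which cancels the extra summand
   [k = n + 1]. *)
rewrite addrAC -sumrB rising_sum_telescope // /rising_coef !binn.
rewrite /shifted_squares !big_geq // [rising (2%:R * x - y + _) n.+1]risingS.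
by apply/eqP; rewrite [(-1) ^+ n.+1]exprS natrM -[n.+2%:R]natr1 -[n.+1%:R]natr1; ring.
Qed.

End PfaffSaalschutz.

(** Applied to [polyC]: the coefficients are constant in [s], so differentiation only affects the
    shifted squares. *)
Lemma rmorph_rising_coef (A B : comNzRingType) (f : {rmorphism A -> B})
  (x y : A) (n k : nat) :
  f (rising_coef x y n k) = rising_coef (f x) (f y) n k.
Proof.
rewrite /rising_coef /rising !rmorphM rmorphXn rmorphN1 rmorph_nat !rmorph_prod.
congr (_ * (_ * _)); apply: eq_bigr => i _.
  by rewrite rmorphD rmorph_nat.
by rewrite !rmorphD rmorphN rmorphM !rmorph_nat.
Qed.

Section Harmonic.

Variable F : fieldType.
Implicit Types x y u : F.

(** Logarithmic derivative at 0: the factor with constant term [c j] contributes [- (c j)^-1]. *)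
Lemma deriv_prod_subX0 (r : seq nat) (c : nat -> F) :
  {in r, forall j, c j != 0} ->
  (\prod_(j <- r) ((c j)%:P - 'X))^`().[0]
  = - (\prod_(j <- r) c j) * \sum_(j <- r) (c j)^-1.
Proof.
elim: r => [|j r IHr] c_neq0; first by rewrite !big_nil derivC horner0 mulr0.
have cj0 : c j != 0 by rewrite c_neq0 ?mem_head.
have cr0 : {in r, forall i, c i != 0}.
  by move=> i ir; rewrite c_neq0 // inE ir orbT.
rewrite !big_cons derivM hornerD !hornerM IHr // derivB derivC derivX.
rewrite horner_prod sub0r hornerN hornerC hornerD hornerN hornerC hornerX.
under eq_bigr do rewrite hornerD hornerN hornerC hornerX subr0.
by field.
Qed.

Lemma deriv_shifted_squares0 x k n :
  (forall j, (0 < j <= n)%N -> x + j%:R != 0) ->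
  (shifted_squares x%:P 'X k n)^`().[0]
  = - shifted_squares x 0 k n * \sum_(k <= j < n) ((x + j.+1%:R) ^+ 2)^-1.
Proof.
move=> x_neq; rewrite /shifted_squares.
under eq_bigr do rewrite -polyC_natr -polyCD -polyC_exp.
rewrite deriv_prod_subX0 => [|j]; last first.
  by rewrite mem_index_iota => /andP[_ jn]; rewrite expf_neq0 ?x_neq.
by under [in RHS]eq_bigr do rewrite subr0.
Qed.

Lemma gharmE l n u : gharm l n u = \sum_(0 <= j < n) ((u + j.+1%:R) ^+ l)^-1.
Proof. by rewrite /gharm big_add1; apply: eq_bigr => j _; rewrite div1r. Qed.

(** Differentiation produces the tails [gharm 2 n x - gharm 2 k x] with a minus sign; adding
    [gharm 2 n x] times the identity at [s = 0] leaves [gharm 2 k x]. *)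
Lemma pfaff_saalschutz_harmonic x y n :
  (forall j, (0 < j <= n)%N -> x + j%:R != 0) ->
  (forall j, (0 < j <= n)%N -> x - y + j%:R != 0) ->
  \sum_(0 <= k < n.+1)
    rising_coef x y n k * shifted_squares x 0 k n * gharm 2 k x
  = shifted_squares (x - y) 0 0 n * (gharm 2 n x - gharm 2 n (x - y)).
Proof.
move=> x_neq xy_neq.
(* Taking [s] to be the indeterminate makes the derivative formal, hence available over any
   field. *)
have := pfaff_saalschutz x%:P y%:P 'X n => /(congr1 (fun p => p^`().[0])).
rewrite -polyCB deriv_shifted_squares0 // raddf_sum horner_sum -gharmE => dE.
rewrite mulrBr -{1}pfaff_saalschutz mulr_suml -mulNr -dE -big_split /=.
apply: eq_big_nat => k /andP[_]; rewrite ltnS => kn.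
rewrite -rmorph_rising_coef mul_polyC derivZ hornerZ deriv_shifted_squares0 //.
by rewrite !gharmE [\sum_(0 <= j < n) _](big_cat_nat (n := k)) //=; ring.
Qed.

Lemma gbinom_rising u k :
  gbinom (u + k%:R) k = rising (u + 1) k / k`!%:R.
Proof.
rewrite /gbinom /rising big_mkord (reindex_inj rev_ord_inj) /=; congr (_ / _).
apply: eq_bigr => i _.
by rewrite natrB // opprB -natr1; ring.
Qed.

(** At [s = 0] the lower parameters [x + 1 + t] and [x + 1 - t] coincide, which is the source of the
    squared binomials. *)
Lemma sqr_rising x n : rising (x + 1) n ^+ 2 = shifted_squares x 0 0 n.
Proof.
rewrite /rising /shifted_squares -prodrXl; apply: eq_bigr => j _.
by rewrite subr0 -natr1 -addrA [1 + _]addrC.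
Qed.

End Harmonic.

Lemma gbinom_sum_gharm (F : fieldType) (charF0 : [pchar F] =i pred0)
  (n : nat) (x y : F)
  (hx : forall j : nat, (1 <= j <= n)%N -> x <> - j%:R)
  (hxy : forall j : nat, (1 <= j <= n)%N -> x - y <> - j%:R)
  (hy : forall j : nat, (j <= n)%N -> y <> - j%:R) :
  \sum_(0 <= k < n.+1)
     (-1) ^+ k * ('C(n, k))%:R
     * (gbinom (2%:R * x - y + n%:R + k%:R) k * gbinom (y + k%:R) k
        / gbinom (x + k%:R) k ^+ 2)
     * (y / (y + k%:R)) * gharm 2 k x
  = gbinom (x - y + n%:R) n ^+ 2 / gbinom (x + n%:R) n ^+ 2
    * (gharm 2 n x - gharm 2 n (x - y)).
Proof.
have x_neq j : (0 < j <= n)%N -> x + j%:R != 0.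
  by move=> /hx xj; rewrite addr_eq0; apply/eqP.
have xy_neq j : (0 < j <= n)%N -> x - y + j%:R != 0.
  by move=> /hxy xyj; rewrite addr_eq0; apply/eqP.
have y_neq j : (j <= n)%N -> y + j%:R != 0.
  by move=> /hy yj; rewrite addr_eq0; apply/eqP.
have fact_neq0 k : k`!%:R != 0 :> F.
  by rewrite ((pcharf0P F).1 charF0) -lt0n fact_gt0.
have squares_neq0 k m : (m <= n)%N -> shifted_squares x 0 k m != 0.
  move=> mn; rewrite /shifted_squares prodf_seq_neq0; apply/allP => j /=.
  rewrite mem_index_iota => /andP[_ jm]; rewrite subr0 expf_neq0 // x_neq //.
  exact: leq_trans jm mn.
have gbinom_ratio (u v : F) m : gbinom (u + m%:R) m / gbinom (v + m%:R) m
    = rising (u + 1) m / rising (v + 1) m.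
  by rewrite !gbinom_rising invf_div mulrA divfK ?fact_neq0.
rewrite -expr_div_n gbinom_ratio expr_div_n !sqr_rising mulrAC.
(* Both sides are now sums over [k], the right one divided by [shifted_squares x 0 0 n], and are
   compared term by term. *)
rewrite -pfaff_saalschutz_harmonic // mulr_suml.
apply: eq_big_nat => k /andP[_]; rewrite ltnS => kn.
rewrite [RHS]mulrAC; congr (_ * _).
rewrite !gbinom_rising expr_div_n sqr_rising.
have -> : shifted_squares x 0 0 n
    = shifted_squares x 0 0 k * shifted_squares x 0 k n.
  by rewrite /shifted_squares (big_cat_nat (n := k)).
(* Both products are (y)_{k+1}; thus the factor [y / (y + k)] turns (y+1)_k into (y)_k. *)
have rising_y : rising (y + 1) k * y = rising y k * (y + k%:R).
  by rewrite mulrC -rising_recl risingS.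
rewrite /rising_coef -[2%:R * x - y + n%:R + 1]addrA natr1.
have yk := y_neq k kn; have kf := fact_neq0 k.
have q1 := squares_neq0 0%N k kn; have q2 := squares_neq0 k n (leqnn n).
have -> : rising y k = rising (y + 1) k * y / (y + k%:R).
  by rewrite rising_y mulfK.
by field; rewrite q1 q2 yk kf.
Qed.

Theorem theorem2 (R : realType) (n : nat) (x y : R[i])
  (hx : forall j : nat, (1 <= j <= n)%N -> x <> - j%:R)
  (hxy : forall j : nat, (1 <= j <= n)%N -> x - y <> - j%:R)
  (hy : forall j : nat, (j <= n)%N -> y <> - j%:R) :
  \sum_(0 <= k < n.+1)
     (-1) ^+ k * ('C(n, k))%:R
     * (gbinom (2%:R * x - y + n%:R + k%:R) k * gbinom (y + k%:R) k
        / gbinom (x + k%:R) k ^+ 2)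
     * (y / (y + k%:R)) * gharm 2 k x
  = gbinom (x - y + n%:R) n ^+ 2 / gbinom (x + n%:R) n ^+ 2
    * (gharm 2 n x - gharm 2 n (x - y)).
Proof. exact: gbinom_sum_gharm (Num.Theory.pchar_num _) n x y hx hxy hy. Qed.
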